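(* Let $\lambda$ and $\rho$ be two distributions over $\{0,1\}^d$. For any $\epsilon\in(0,1/2)$ and any integers $d,\ell\in\mathbb{N}_+$, there exists a deterministic communication protocol for set disjointness over $\lambda\times\rho$ with $\epsilon$ type II error, in which Alice sends at most $\ell+\lceil d/\ell\rceil\cdot\log(3e\ell)$ bits and Bob sends at most $2\ell\cdot\log(16\ell/\epsilon)$ bits.
   Context: Vectors in $\{0,1\}^d$ are identified with subsets of $[d]$. Set disjointness: $f(x,y)=1$ iff $x\cap y=\emptyset$. A deterministic two-party protocol $\pi$ (Alice holds $x$, Bob holds $y$, both know $\lambda,\rho$) for $f$ over $\lambda\times\rho$ has $\epsilon$ error if $\Pr_{x\sim\lambda,y\sim\rho}[\pi(x,y)\neq f(x,y)]\leq\epsilon$; it has type II error if it can be incorrect only when $f(x,y)=1$. Logarithms base 2. *)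

(* Defs.v *)
From mathcomp Require Import all_boot all_order all_algebra.
From mathcomp Require Import reals sequences exp.

Set Implicit Arguments.
Unset Strict Implicit.
Unset Printing Implicit Defensive.

Import GRing.Theory Num.Theory.

Local Open Scope ring_scope.

Record dist (R : realType) (T : finType) := Dist {
  pmf :> {ffun T -> R};
  pmf_ge0 : forall t, 0 <= pmf t;
  pmf_sum1 : \sum_t pmf t = 1
}.

Definition prob_prod (R : realType) (X Y : finType)
    (lambda : dist R X) (rho : dist R Y) (E : X -> Y -> bool) : R :=
  \sum_(xy : X * Y | E xy.1 xy.2) lambda xy.1 * rho xy.2.

(* A protocol tree: at an internal node the named player sends one bit, which *)
(* depends only on that player's input (and, through the node, on the bits    *)
(* exchanged so far); the bit true leads to the first subtree. The output is  *)
(* determined by the transcript, hence known to both players.                 *)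
Inductive protocol (X Y Z : Type) : Type :=
| Output of Z
| AliceSends of (X -> bool) & protocol X Y Z & protocol X Y Z
| BobSends of (Y -> bool) & protocol X Y Z & protocol X Y Z.

Section Run.
Context {X Y Z : Type}.
Implicit Types (p : protocol X Y Z) (x : X) (y : Y).

Fixpoint run p x y : Z :=
  match p with
  | Output z => z
  | AliceSends a p1 p0 => if a x then run p1 x y else run p0 x y
  | BobSends b p1 p0 => if b y then run p1 x y else run p0 x y
  end.

Fixpoint alice_bits p x y : nat :=
  match p with
  | Output _ => 0
  | AliceSends a p1 p0 =>
      (if a x then alice_bits p1 x y else alice_bits p0 x y).+1
  | BobSends b p1 p0 => if b y then alice_bits p1 x y else alice_bits p0 x y
  end.

Fixpoint bob_bits p x y : nat :=
  match p with
  | Output _ => 0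
  | AliceSends a p1 p0 => if a x then bob_bits p1 x y else bob_bits p0 x y
  | BobSends b p1 p0 =>
      (if b y then bob_bits p1 x y else bob_bits p0 x y).+1
  end.

End Run.

Definition has_error (R : realType) (X Y : finType) (f : X -> Y -> bool)
    (lambda : dist R X) (rho : dist R Y) (p : protocol X Y bool) (eps : R) :=
  prob_prod lambda rho (fun x y => run p x y != f x y) <= eps.

Definition type_II (X Y : Type) (f : X -> Y -> bool) (p : protocol X Y bool) :=
  forall x y, run p x y <> f x y -> f x y = true.

(* Vectors of {0,1}^d are represented as subsets of 'I_d. *)
Definition set_disj (d : nat) (x y : {set 'I_d}) : bool := x :&: y == set0.

Definition log2 (R : realType) (x : R) : R := ln x / ln 2.

(* Main.v *)
Require Import Defs.
From mathcomp Require Import all_boot all_order all_algebra.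
From mathcomp Require Import boolp reals sequences exp.
From mathcomp Require Import ring lra zify.

(** Let m = ceil(d/l). The players maintain a set U containing Bob's set y,
    initially the whole universe. In each round Alice says whether
    [#|x :&: U| < m]; if so, she sends [x :&: U] and Bob answers exactly.
    Otherwise Bob looks in a fixed list of sets, each meeting U in at least m
    points, for one that is disjoint from y: he sends its index and its elements
    leave U, or, if there is none, the players answer "not disjoint". After l
    rounds U is empty.

    The list depends on the transcript. By averaging over Alice's conditional
    distribution it can be built greedily so that, up to Bob-probability e1, it
    serves every y that is disjoint from x with conditional probability at
    least e0; length 1 / (e0 e1) suffices. The total error is at most e0 + l e1,
    and e0 = eps / 2, e1 = eps / (2 l). *)

Import Order.TTheory GRing.Theory Num.Theory.

Local Open Scope ring_scope.

(** * Sending a number in binary *)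

(** Least significant bit first: each bit sent halves [f] and reindexes the continuation, so the
    protocol goes on as [c (f x %% 2 ^ n)]. *)
Fixpoint alice_sends_nat {X Y Z : Type} (n : nat) (f : X -> nat)
    (c : nat -> protocol X Y Z) : protocol X Y Z :=
  if n is n'.+1 then
    AliceSends (fun x => odd (f x))
      (alice_sends_nat n' (fun x => (f x)./2) (fun i => c i.*2.+1))
      (alice_sends_nat n' (fun x => (f x)./2) (fun i => c i.*2))
  else c 0%N.

Fixpoint bob_sends_nat {X Y Z : Type} (n : nat) (f : Y -> nat)
    (c : nat -> protocol X Y Z) : protocol X Y Z :=
  if n is n'.+1 then
    BobSends (fun y => odd (f y))
      (bob_sends_nat n' (fun y => (f y)./2) (fun i => c i.*2.+1))
      (bob_sends_nat n' (fun y => (f y)./2) (fun i => c i.*2))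
  else c 0%N.

Lemma run_alice_sends_nat {X Y Z : Type} (n : nat) (f : X -> nat)
    (c : nat -> protocol X Y Z) (x : X) (y : Y) :
  (f x < 2 ^ n)%N -> run (alice_sends_nat n f c) x y = run (c (f x)) x y.
Proof.
elim: n f c => [|n IHn] f c; first by rewrite expn0 ltnS leqn0 => /eqP->.
rewrite expnS mul2n => fx_lt /=.
have half_lt : ((f x)./2 < 2 ^ n)%N by rewrite ltn_half_double.
rewrite !IHn // -[in RHS](odd_double_half (f x)).
by case: odd.
Qed.

Lemma run_bob_sends_nat {X Y Z : Type} (n : nat) (f : Y -> nat)
    (c : nat -> protocol X Y Z) (x : X) (y : Y) :
  (f y < 2 ^ n)%N -> run (bob_sends_nat n f c) x y = run (c (f y)) x y.
Proof.
elim: n f c => [|n IHn] f c; first by rewrite expn0 ltnS leqn0 => /eqP->.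
rewrite expnS mul2n => fy_lt /=.
have half_lt : ((f y)./2 < 2 ^ n)%N by rewrite ltn_half_double.
rewrite !IHn // -[in RHS](odd_double_half (f y)).
by case: odd.
Qed.

Lemma bits_alice_sends_nat {X Y Z : Type} (n A B : nat) (f : X -> nat)
    (c : nat -> protocol X Y Z) (x : X) (y : Y) :
  (forall i, (alice_bits (c i) x y <= A)%N /\ (bob_bits (c i) x y <= B)%N) ->
  (alice_bits (alice_sends_nat n f c) x y <= n + A)%N /\
  (bob_bits (alice_sends_nat n f c) x y <= B)%N.
Proof.
elim: n f c => [|n IHn] f c cAB /=; first exact: cAB.
by case: odd; rewrite addSn ltnS; apply: IHn.
Qed.

Lemma bits_bob_sends_nat {X Y Z : Type} (n A B : nat) (f : Y -> nat)
    (c : nat -> protocol X Y Z) (x : X) (y : Y) :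
  (forall i, (alice_bits (c i) x y <= A)%N /\ (bob_bits (c i) x y <= B)%N) ->
  (alice_bits (bob_sends_nat n f c) x y <= A)%N /\
  (bob_bits (bob_sends_nat n f c) x y <= n + B)%N.
Proof.
elim: n f c => [|n IHn] f c cAB /=; first exact: cAB.
by case: odd; rewrite addSn ltnS; apply: IHn.
Qed.

(** * Greedy lists by averaging *)

(** Otherwise the nonnegative terms [a x * (g x - c)] have a sum at most 0, so all vanish and [a] is
    zero. The positive weight of the witness later ensures that the sets in Bob's list are large. *)
Lemma weighted_mean_witness {R : realType} {X : finType} (a g : X -> R) (c : R) :
  (forall x, 0 <= a x) -> 0 < \sum_x a x ->
  \sum_x a x * g x <= c * \sum_x a x -> exists2 x, 0 < a x & g x <= c.
Proof.
move=> a_ge0 A_gt0 mean_le; apply: contrapT => noW.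
have g_gt x : 0 < a x -> c < g x.
  by move=> ax_gt0; rewrite ltNge; apply/negP => gx_le; apply: noW; exists x.
have term_ge0 x : 0 <= a x * (g x - c).
  have := a_ge0 x; rewrite le_eqVlt => /orP[/eqP<-|ax_gt0]; first by rewrite mul0r.
  by rewrite mulr_ge0 // subr_ge0 ltW // g_gt.
have sum_eq0 : \sum_x a x * (g x - c) = 0.
  apply/eqP; rewrite eq_le sumr_ge0 // andbT.
  under eq_bigr do rewrite mulrBr [_ * c]mulrC.
  by rewrite sumrB -mulr_sumr subr_le0.
move: A_gt0; rewrite big1 ?ltxx // => x _.
have := a_ge0 x; rewrite le_eqVlt => /orP[/eqP<-//|ax_gt0].
have /(_ x isT)/eqP := psumr_eq0P (fun x _ => term_ge0 x) sum_eq0.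
by rewrite mulf_eq0 (gt_eqF ax_gt0) subr_eq0 (gt_eqF (g_gt x ax_gt0)).
Qed.

(* Each new element of [s], chosen by averaging over [a], misses at most a
   fraction [1 - e] of the [b]-mass of frequently related [y] still unrelated
   to [s]. *)
Lemma greedy_hitting_seq {R : realType} {X Y : finType} (a : X -> R) (b : Y -> R)
    (D : X -> Y -> bool) (e : R) (N : nat) :
  (forall x, 0 <= a x) -> (forall y, 0 <= b y) -> 0 <= e <= 1 ->
  exists s : seq X,
    [/\ (size s <= N)%N, {in s, forall x, 0 < a x} &
      (\sum_x a x) *
      \sum_(y | (e * (\sum_x a x) <= \sum_(x | D x y) a x) && ~~ has (D^~ y) s) b y
      <= (\sum_x a x) * ((1 - e) ^+ N * \sum_y b y)].
Proof.
move=> a_ge0 b_ge0 /andP[e_ge0 e_le1]; set A := \sum_x a x.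
have A_ge0 : 0 <= A by exact: sumr_ge0.
(* The factor [A] on both sides lets the empty list serve when [a] has no mass, so no normalisation
   is required. *)
have [A_eq0|A_neq0] := eqVneq A 0.
  by exists [::]; split=> //; rewrite A_eq0 !mul0r.
have A_gt0 : 0 < A by rewrite lt_def A_neq0.
elim: N => [|N [s [size_s s_gt0 s_le]]].
  exists [::]; split=> //; rewrite ler_wpM2l // expr0 mul1r.
  rewrite [leRHS](bigID (fun y => e * A <= \sum_(x | D x y) a x)) /=.
  under eq_bigl do rewrite andbT.
  by rewrite lerDl sumr_ge0.
set good := fun y => e * A <= \sum_(x | D x y) a x.
pose W t := \sum_(y | good y && ~~ has (D^~ y) t) b y.
have [x ax_gt0 Wx] : exists2 x, 0 < a x & W (x :: s) <= (1 - e) * W s.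
  apply: weighted_mean_witness => //.
  (* Exchanging the sums, each unhit [y] is weighted by the [a]-mass of the [x] that miss it, at
     most [(1 - e) * A] when [y] is good. *)
  have -> : \sum_x a x * W (x :: s) =
      \sum_(y | good y && ~~ has (D^~ y) s) b y * \sum_(x | ~~ D x y) a x.
    rewrite /W; under eq_bigr do rewrite mulr_sumr big_mkcond.
    rewrite exchange_big [RHS]big_mkcond; apply: eq_bigr => y _.
    case: (boolP (good y && _)) => [/andP[gy ns]|ns].
      rewrite mulr_sumr [RHS]big_mkcond; apply: eq_bigr => x _ /=.
      by rewrite gy negb_or ns andbT mulrC.
    rewrite big1 // => x _; rewrite ifF //.
    by apply: contraNF ns => /=; rewrite negb_or => /and3P[-> _ ->].
  rewrite -/A mulrAC /W mulr_sumr; apply: ler_sum => y /andP[gy _].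
  rewrite [leRHS]mulrC ler_wpM2l //.
  have : A = \sum_(x | D x y) a x + \sum_(x | ~~ D x y) a x.
    by rewrite /A (bigID (D^~ y)).
  by move: gy; rewrite /good -/A; lra.
exists (x :: s); split=> //.
  by move=> z; rewrite inE => /predU1P[->|/s_gt0].
rewrite exprS -mulrA mulrCA; apply: (@le_trans _ _ ((1 - e) * (A * W s))).
  by rewrite mulrCA ler_wpM2l.
by rewrite ler_wpM2l // subr_ge0.
Qed.

(** By induction, from [(1 - e) * (1 + (N + 1) * e) <= 1 + N * e]. *)
Lemma expr_onem_bernoulli {R : realType} (e : R) (N : nat) :
  0 <= e <= 1 -> (1 - e) ^+ N * (1 + N%:R * e) <= 1.
Proof.
move=> /andP[e_ge0 e_le1]; elim: N => [|N IHN]; first by rewrite expr0; lra.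
apply: le_trans IHN; rewrite exprSr -mulrA ler_wpM2l ?exprn_ge0 ?subr_ge0 //.
rewrite -natr1; have := ler0n R N; set n := N%:R; nra.
Qed.

(** The power is at most [1 / (N * e)], hence at most [e']. This crude length is affordable because
    Bob only pays its logarithm. *)
Lemma expr_onem_le {R : realType} (e e' : R) (N : nat) :
  0 < e <= 1 -> 0 < e' -> (e * e')^-1 <= N%:R -> (1 - e) ^+ N <= e'.
Proof.
move=> /andP[e_gt0 e_le1] e'_gt0 N_ge.
have bern : (1 - e) ^+ N * (1 + N%:R * e) <= 1.
  by apply: expr_onem_bernoulli; rewrite ltW.
have pow_ge0 : 0 <= (1 - e) ^+ N by rewrite exprn_ge0 // subr_ge0.
have N1 : 1 <= N%:R * e * e'.
  by rewrite -mulrA -ler_pdivrMr ?mulr_gt0 // mul1r.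
set P := (1 - e) ^+ N in bern pow_ge0 *; set n := N%:R * e in bern N1.
have P_le : P * n <= 1 by lra.
have n_gt0 : 0 < n by move: N1; rewrite -(pmulr_lgt0 _ e'_gt0); lra.
rewrite -(ler_pM2r n_gt0); lra.
Qed.

(** * The protocol, round by round *)

Lemma sum_has_find {R : realType} {X Y : finType} (D : X -> Y -> bool)
    (s : seq X) (F : Y -> R) :
  \sum_(y | has (D^~ y) s) F y =
  \sum_(i < size s) \sum_(y | find (D^~ y) s == i) F y.
Proof.
under [RHS]eq_bigr do rewrite big_mkcond.
rewrite exchange_big [LHS]big_mkcond; apply: eq_bigr => y _ /=.
case: ifPn => [|no_hit]; last first.
  rewrite big1 // => i _; case: eqP => // find_i.
  by move: no_hit; rewrite has_find find_i ltn_ord.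
rewrite has_find => find_lt; rewrite (bigD1 (Ordinal find_lt)) //= eqxx.
by rewrite big1 ?addr0 // => i; rewrite -val_eqE /= eq_sym => /negbTE->.
Qed.

Lemma set_disj_capl {d : nat} (x y U : {set 'I_d}) :
  y \subset U -> set_disj (x :&: U) y = set_disj x y.
Proof. by move=> /setIidPr yU; rewrite /set_disj -setIA yU. Qed.

(** The weights need not sum to 1: conditioning on the transcript becomes restricting [a] and [b],
    with no division by a possibly zero mass. *)
Definition rect_error {R : realType} {d : nat}
    (p : protocol {set 'I_d} {set 'I_d} bool) (a b : {set 'I_d} -> R)
    (U : {set 'I_d}) : R :=
  \sum_x \sum_(y : {set 'I_d} | (y \subset U) && (run p x y != set_disj x y))
    a x * b y.

(* Bob's list only has to work for the [y] which are disjoint from a fraction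
   [e0] of the [a]-mass; on any other [y], answering [false] is a relative error
   [e0], paid only once since it ends the protocol. *)
Lemma rounds_protocol {R : realType} (d m M B N : nat) (e0 e1 : R) :
  (0 < B)%N -> (#|[set s : {set 'I_d} | #|s| < m]| <= 2 ^ M)%N ->
  (N < 2 ^ B)%N -> 0 <= e0 <= 1 -> 0 <= e1 -> (1 - e0) ^+ N <= e1 ->
  forall (k : nat) (U : {set 'I_d}) (a b : {set 'I_d} -> R),
  (#|U| <= k * m)%N -> (forall x, 0 <= a x) -> (forall y, 0 <= b y) ->
  exists p : protocol {set 'I_d} {set 'I_d} bool,
    [/\ rect_error p a b U <= (e0 + k%:R * e1) * (\sum_x a x) * (\sum_y b y),
        forall x y : {set 'I_d}, y \subset U -> run p x y -> set_disj x y &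
        forall x y, (alice_bits p x y <= k + M)%N /\
                    (bob_bits p x y <= k * B)%N].
Proof.
move=> B_gt0 smallM NB e0_01 e1_ge0 e1_ge; have /andP[e0_ge0 _] := e0_01.
elim=> [|k IHk] U a b card_U a_ge0 b_ge0.
  have U0 : U = set0 by apply/eqP; rewrite -cards_eq0 -leqn0.
  have disj0 (x y : {set 'I_d}) : y \subset U -> set_disj x y.
    by rewrite U0 subset0 => /eqP->; rewrite /set_disj setI0.
  exists (Output _ _ true); split=> //= [|x y yU _]; last exact: disj0.
  rewrite /rect_error big1 ?mulr_ge0 ?addr_ge0 ?sumr_ge0 ?mul0r // => x _.
  by rewrite big1 // => y /andP[/disj0->].
pose large (x : {set 'I_d}) := (m <= #|x :&: U|)%N.
pose a' x := if large x then a x else 0.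
have a'_ge0 x : 0 <= a' x by rewrite /a'; case: ifP.
have a'_le x : a' x <= a x by rewrite /a'; case: ifP.
have [s [size_s s_gt0 s_le]] :=
  greedy_hitting_seq a' b (@set_disj d) e0 N a'_ge0 b_ge0 e0_01.
pose A := \sum_x a' x; rewrite -/A in s_le.
have A_ge0 : 0 <= A by exact: sumr_ge0.
(* [find] returns [size s] when no listed set is disjoint from [y]; this extra index is Bob's
   message that there is none. *)
pose hit (y : {set 'I_d}) := find ((@set_disj d)^~ y) s.
pose U' i := U :\: nth set0 s i.
pose b' i y := if hit y == i then b y else 0.
(* The induction hypothesis serves the indices inside the list; beyond it the answer is [false].
   Soundness and bit counts are asked of every [i], as the bit-counting lemma quantifies over all
   continuations. *)
have next_round i : exists p : protocol {set 'I_d} {set 'I_d} bool,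
    [/\ (i < size s)%N -> rect_error p a' (b' i) (U' i) <=
          (e0 + k%:R * e1) * A * (\sum_y b' i y),
        (size s <= i)%N -> p = Output _ _ false,
        forall x y : {set 'I_d}, y \subset U' i -> run p x y -> set_disj x y &
        forall x y, (alice_bits p x y <= k + M)%N /\
                    (bob_bits p x y <= k * B)%N].
  case: (ltnP i (size s)) => [lt_i|ge_i]; last first.
    by exists (Output _ _ false).
  have card_U' : (#|U' i| <= k * m)%N.
    (* Listed sets have positive [a'] weight, so they are large and [U' i] loses at least [m]
       points. *)
    have : large (nth set0 s i).
      by have := s_gt0 _ (mem_nth set0 lt_i); rewrite /a'; case: ifP; rewrite ?ltxx.
    rewrite /large cardsD setIC => large_i.
    by rewrite leq_subLR; apply: leq_trans card_U _; rewrite mulSn leq_add2r.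
  have b'_ge0 y : 0 <= b' i y by rewrite /b'; case: ifP.
  by have [p []] := IHk (U' i) a' (b' i) card_U' a'_ge0 b'_ge0; exists p.
have [c cP] := choice next_round.
pose L := enum [set t : {set 'I_d} | #|t| < m]%N.
pose p := AliceSends large (bob_sends_nat B hit c)
  (alice_sends_nat M (fun x => index (x :&: U) L)
    (fun i => BobSends (set_disj (nth set0 L i))
                (Output _ _ true) (Output _ _ false))).
have run_large x y : large x -> run p x y = run (c (hit y)) x y.
  move=> x_large /=; rewrite x_large run_bob_sends_nat //.
  by apply: leq_ltn_trans (find_size _ _) _; apply: leq_ltn_trans size_s NB.
have run_small (x y : {set 'I_d}) : ~~ large x -> y \subset U -> run p x y = set_disj x y.
  move=> x_small yU /=; rewrite (negbTE x_small).
  have xL : x :&: U \in L by rewrite mem_enum inE ltnNge.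
  rewrite run_alice_sends_nat /=; last first.
    by apply: leq_trans smallM; rewrite cardE index_mem.
  by rewrite nth_index // set_disj_capl //; case: set_disj.
have sub_U' (y : {set 'I_d}) : y \subset U -> has ((@set_disj d)^~ y) s -> y \subset U' (hit y).
  move=> yU has_y; rewrite /U' subsetD yU -setI_eq0 setIC.
  exact: (nth_find set0 has_y).
exists p; split; last 2 first.
- move=> x y yU; have [x_large|x_small] := boolP (large x); last first.
    by rewrite run_small.
  rewrite run_large //; have [_ c_out c_sound _] := cP (hit y).
  have [has_y|no_hit] := boolP (has ((@set_disj d)^~ y) s).
    by apply: c_sound; exact: sub_U'.
  by rewrite c_out // leqNgt -has_find.
- move=> x y /=; case: ifP => _.
    rewrite addSn ltnS mulSn; apply: bits_bob_sends_nat => i.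
    by have [_ _ _] := cP i.
  (* A small [x :&: U] ends the protocol; Bob's single bit fits in his budget because [B] is
     positive. *)
  have [] := @bits_alice_sends_nat _ _ _ M 0 1
    (fun x => index (x :&: U) L)
    (fun i => BobSends (set_disj (nth set0 L i))
                (Output _ _ true) (Output _ _ false)) x y.
    by move=> i /=; case: ifP.
  rewrite addn0 => alice_le bob_le; split; first lia.
  by apply: leq_trans bob_le _; rewrite muln_gt0.
(* Only pairs with [x] large contribute error, the small case being answered exactly. *)
pose T (x y : {set 'I_d}) := if (y \subset U) && (run (c (hit y)) x y != set_disj x y)
  then a' x * b y else 0.
have err_le : rect_error p a b U <= \sum_y \sum_x T x y.
  rewrite exchange_big; apply: ler_sum => x _.
  rewrite big_mkcond; apply: ler_sum => y _; rewrite /T /a'.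
  have [x_large|x_small] := boolP (large x); first by rewrite run_large.
  rewrite mul0r if_same; case: ifP => // /andP[yU].
  by rewrite run_small // eqxx.
apply: (le_trans err_le).
rewrite (bigID (fun y => has ((@set_disj d)^~ y) s)) /=.
have hit_le : \sum_(y | has ((@set_disj d)^~ y) s) \sum_x T x y <=
    (e0 + k%:R * e1) * A * \sum_(y | has ((@set_disj d)^~ y) s) b y.
  (* Grouping the [y] by Bob's message turns the error into a sum of the rectangle errors of the
     next round. *)
  rewrite !sum_has_find mulr_sumr; apply: ler_sum => i _.
  have [c_err _ _ _] := cP i; rewrite [X in _ * X]big_mkcond.
  apply: le_trans (c_err (ltn_ord i)).
  rewrite /rect_error exchange_big /=; apply: ler_sum => x _.
  rewrite big_mkcond [leRHS]big_mkcond; apply: ler_sum => y _ /=.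
  rewrite /b' /T -/(hit y); case: (eqVneq (hit y) i) => [hit_i|_]; last first.
    by rewrite mulr0 if_same.
  rewrite hit_i; case: ifP => [/andP[yU ->]|_].
    by rewrite andbT -hit_i sub_U' // has_find -/(hit y) hit_i.
  by case: ifP => // _; rewrite mulr_ge0.
have miss_le y : ~~ has ((@set_disj d)^~ y) s ->
    \sum_x T x y <= b y * \sum_(x | set_disj x y) a' x.
  move=> no_hit; rewrite mulr_sumr [leRHS]big_mkcond; apply: ler_sum => x _.
  have [_ c_out _ _] := cP (hit y).
  rewrite /T c_out /=; last by rewrite leqNgt -has_find.
  case: (y \subset U) => /=; case: set_disj => //=; last by rewrite mulr_ge0.
  by rewrite mulrC.
set good := fun y => e0 * A <= \sum_(x | set_disj x y) a' x.
(* A missed [y] that is not good errs on [a']-mass at most [e0 * A]; a good one may err on all of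
   [A], but the missed good ones have small [b]-mass. *)
have missed_le : \sum_(y | ~~ has ((@set_disj d)^~ y) s) \sum_x T x y <=
    e0 * A * \sum_(y | ~~ has ((@set_disj d)^~ y) s) b y +
    A * \sum_(y | good y && ~~ has ((@set_disj d)^~ y) s) b y.
  rewrite [X in _ + A * X](_ : _ =
    \sum_(y | ~~ has ((@set_disj d)^~ y) s) (if good y then b y else 0)).
    rewrite [X in X + _]mulr_sumr [X in _ + X]mulr_sumr -big_split; apply: ler_sum => y no_hit /=.
    apply: le_trans (miss_le y no_hit) _; rewrite /good.
    case: ifPn => [_|]; last rewrite -ltNge => /ltW bad.
      rewrite ler_wpDl ?mulr_ge0 // [leRHS]mulrC ler_wpM2l //.
      by rewrite [leRHS](bigID (fun x => set_disj x y)) /= lerDl sumr_ge0.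
    by rewrite mulr0 addr0 mulrC ler_wpM2r.
  by rewrite -big_mkcondr; apply: eq_bigl => y; rewrite andbC.
have b_split : \sum_y b y = \sum_(y | has ((@set_disj d)^~ y) s) b y +
    \sum_(y | ~~ has ((@set_disj d)^~ y) s) b y.
  exact: bigID.
have b_sum_ge0 : 0 <= \sum_y b y by exact: sumr_ge0.
have uncovered_le : A * \sum_(y | good y && ~~ has ((@set_disj d)^~ y) s) b y <=
    A * (e1 * \sum_y b y).
  by apply: (le_trans s_le); rewrite ler_wpM2l // ler_wpM2r.
have A_le : A <= \sum_x a x by exact: ler_sum.
(* The slack that extends the factor [e0 + k * e1] from the hit [y] to all of them; the missed good
   [y] supply the last [e1]. *)
have missed_ge0 : 0 <= k%:R * e1 * A *
    \sum_(y | ~~ has ((@set_disj d)^~ y) s) b y.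
  by rewrite !mulr_ge0 // sumr_ge0.
apply: (@le_trans _ _ ((e0 + k.+1%:R * e1) * A * \sum_y b y)); last first.
  by rewrite ler_wpM2r // ler_wpM2l // addr_ge0 // mulr_ge0.
rewrite -natr1; move: hit_le missed_le uncovered_le missed_ge0.
rewrite b_split; lra.
Qed.

(** * Counting small sets, and bit lengths as logarithms *)

(** The binomial theorem in subset form: expand the product of [x + 1] over [T], choosing [x] on [A]
    and 1 off it. *)
Lemma sum_expr_card {R : comNzRingType} (T : finType) (x : R) :
  \sum_(A : {set T}) x ^+ #|A| = (1 + x) ^+ #|T|.
Proof.
rewrite addrC -prodr_const bigA_distr; apply: eq_bigr => A _.
by rewrite -big_mkcond prodr_const.
Qed.

(* Weighting a set [s] by [l ^ (m - |s|)] bounds the count by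
   [l ^ m * (1 + 1 / l) ^ d]. *)
Lemma card_small_sets_le {R : realType} (d l m : nat) :
  (0 < l)%N -> (d <= l * m)%N ->
  #|[set s : {set 'I_d} | (#|s| < m)%N]|%:R <= (expR 1 * l%:R) ^+ m :> R.
Proof.
move=> l_gt0 d_le; have l_gt0R : 0 < l%:R :> R by rewrite ltr0n.
apply: (@le_trans _ _ (l%:R ^+ m * (1 + l%:R^-1) ^+ d)).
  rewrite -[X in _ <= _ * _ ^+ X]card_ord -sum_expr_card mulr_sumr -sum1_card natr_sum.
  rewrite big_mkcond; apply: ler_sum => s _; rewrite inE.
  case: ifP => [/ltnW s_le|_]; last first.
    by rewrite mulr_ge0 // exprn_ge0 // invr_ge0 ltW.
  rewrite -(subnK s_le) exprD exprVn mulfK ?expf_neq0 ?gt_eqF //.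
  by rewrite exprn_ege1 // ler1n.
rewrite exprMn [leLHS]mulrC ler_wpM2r ?exprn_ge0 //.
(* From [1 + 1 / l <= expR (1 / l)], and then [d / l <= m]. *)
apply: (@le_trans _ _ (expR l%:R^-1 ^+ d)).
  by rewrite lerXn2r ?expR_ge1Dx ?nnegrE ?expR_ge0 // addr_ge0 // invr_ge0 ltW.
rewrite -!expRM_natl ler_expR mulr1 ler_pdivrMr //.
by rewrite mulrC -natrM ler_nat.
Qed.

(** The factor 2 lost in rounding to whole bits is absorbed by the constants 3 and 16 of the final
    bounds. *)
Lemma expn_up_log_le (n : nat) : (0 < n)%N -> (2 ^ up_log 2 n <= 2 * n)%N.
Proof.
case: n => [|[|n]] // _.
have /andP[lt_n _] := @up_log_bounds 2 n.+2 isT isT.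
by case: up_log lt_n => [|k] // lt_n; rewrite expnS leq_mul2l /= ltnW.
Qed.

Lemma le_log2_nat {R : realType} (n : nat) (x : R) :
  (2 ^ n)%:R <= x -> n%:R <= log2 x.
Proof.
move=> n_le; have x_gt0 : 0 < x.
  by apply: lt_le_trans n_le; rewrite ltr0n expn_gt0.
rewrite /log2 ler_pdivlMr ?ln_gt0 ?ltr1n //.
by rewrite mulr_natl -lnXn // ler_ln ?posrE ?exprn_gt0 // -natrX.
Qed.

Lemma log2Xn {R : realType} (n : nat) (x : R) :
  0 < x -> log2 (x ^+ n) = n%:R * log2 x.
Proof. by move=> x_gt0; rewrite /log2 lnXn // mulrA mulr_natl. Qed.

(** * Choice of parameters and final bounds *)

Theorem theoremA1 (R : realType) (d l : nat) (hd : (0 < d)%N) (hl : (0 < l)%N)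
    (lambda rho : dist R {set 'I_d}) (eps : R)
    (heps0 : 0 < eps) (heps1 : eps < 1 / 2) :
  exists p : protocol {set 'I_d} {set 'I_d} bool,
    [/\ has_error (@set_disj d) lambda rho p eps,
        type_II (@set_disj d) p,
        forall x y : {set 'I_d},
          (alice_bits p x y)%:R <=
            (l%:R + (Num.ceil (d%:R / l%:R : R))%:~R * log2 (3 * expR 1 * l%:R) : R)
        & forall x y : {set 'I_d},
          (bob_bits p x y)%:R <= (2 * l%:R * log2 (16 * l%:R / eps) : R)].
Proof.
have l_gt0 : 0 < l%:R :> R by rewrite ltr0n.
have l_ge1 : 1 <= l%:R :> R by rewrite ler1n.
have dl_gt0 : 0 < d%:R / l%:R :> R by rewrite divr_gt0 // ltr0n.
have [m m_gt0 ceil_m] : exists2 m : nat,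
    (0 < m)%N & Num.ceil (d%:R / l%:R : R) = m%:Z.
  have : 0 < Num.ceil (d%:R / l%:R : R) by rewrite ceil_gt0.
  by case: Num.ceil => // m m_gt0; exists m.
have d_le : (d <= l * m)%N.
  have := ceil_ge (d%:R / l%:R : R); rewrite ceil_m -pmulrn.
  by rewrite ler_pdivrMr // -natrM ler_nat mulnC.
pose K := #|[set s : {set 'I_d} | (#|s| < m)%N]|.
pose M := up_log 2 K.
have K_gt0 : (0 < K)%N by apply/card_gt0P; exists set0; rewrite inE cards0.
pose e0 := eps / 2; pose e1 := eps / (2 * l%:R).
have e0_gt0 : 0 < e0 by rewrite /e0; lra.
have e1_gt0 : 0 < e1 by rewrite divr_gt0 // mulr_gt0.
have e0e1 : (e0 * e1)^-1 = 4 * l%:R / eps ^+ 2.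
  by rewrite /e0 /e1; field; rewrite !gt_eqF.
pose N := (Num.trunc (e0 * e1)^-1).+1.
have N_gt : (e0 * e1)^-1 < N%:R by exact: truncnS_gt.
have N_le : N%:R <= (e0 * e1)^-1 + 1.
  by rewrite /N -natr1 lerD2r truncn_le invr_ge0 mulr_ge0 // ltW.
(* There are up to [N + 1] messages: the indices of a list of length at most [N], and the one for no
   match. *)
pose B := up_log 2 N.+1.
have B_gt0 : (0 < B)%N by rewrite up_log_gt0.
have NB : (N < 2 ^ B)%N by exact: up_logP.
have [//|||||p [p_err p_sound p_bits]] :=
  @rounds_protocol R d m M B N e0 e1 B_gt0 _ NB _ _ _ l setT
    (pmf lambda) (pmf rho) _ (@pmf_ge0 _ _ lambda) (@pmf_ge0 _ _ rho).
- exact: up_logP.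
- by rewrite ltW //= /e0; lra.
- exact: ltW.
- by apply: expr_onem_le => //; [rewrite e0_gt0 /e0; lra|exact: ltW].
- by rewrite cardsT card_ord.
exists p; split.
- rewrite /has_error /prob_prod.
  apply: le_trans (_ : _ <= rect_error p (pmf lambda) (pmf rho) setT) _.
    rewrite /rect_error pair_big_dep /=.
    by under [leRHS]eq_bigl do rewrite subsetT.
  apply: (le_trans p_err); rewrite !pmf_sum1 !mulr1 /e0 /e1 le_eqVlt.
  by apply/orP; left; apply/eqP; field; rewrite gt_eqF.
- move=> x y; have := p_sound x y (subsetT y).
  by case: (run p x y) => [->|_] //; case: (set_disj x y).
- move=> x y; have [alice_le _] := p_bits x y.
  apply: (@le_trans _ _ (l + M)%:R); first by rewrite ler_nat.
  rewrite natrD lerD2l ceil_m -pmulrn -log2Xn ?mulr_gt0 ?expR_gt0 //.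
  apply: le_log2_nat; apply: (@le_trans _ _ (2 * K)%:R).
    by rewrite ler_nat expn_up_log_le.
  rewrite natrM -mulrA exprMn ler_pM // ?card_small_sets_le //.
  (* As [m] is positive, [3 ^ m] is at least 3 and covers the rounding factor 2. *)
  rewrite -(prednK m_gt0) exprS.
  have : 1 <= 3 ^+ m.-1 :> R by rewrite exprn_ege1 // ler1n.
  lra.
- move=> x y; have [_ bob_le] := p_bits x y.
  apply: (@le_trans _ _ (l * B)%:R); first by rewrite ler_nat.
  have B_le : B%:R <= 2 * log2 (16 * l%:R / eps).
    rewrite -(log2Xn 2) ?divr_gt0 ?mulr_gt0 //.
    apply: le_log2_nat; apply: (@le_trans _ _ (2 * N.+1)%:R).
      by rewrite ler_nat expn_up_log_le.
    rewrite natrM -[N.+1%:R]natr1; apply: (@le_trans _ _ (2 * (4 * l%:R / eps ^+ 2 + 2))).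
      by rewrite -e0e1; lra.
    (* With [i = 1 / eps ^ 2], both [l * i] and the additive constant are at most [l ^ 2 * i], which
       leaves ample room below [256 * l ^ 2 * i]. *)
    have inv_ge1 : 1 <= (eps ^+ 2)^-1.
      by rewrite invf_ge1 ?exprn_gt0 // expr_le1 ?ltW //; lra.
    rewrite expr_div_n; set i := (eps ^+ 2)^-1 in inv_ge1 *.
    have li_ge1 : 1 <= l%:R * i by rewrite mulr_ege1.
    have : l%:R * i <= l%:R * (l%:R * i) by rewrite ler_peMl //; lra.
    by rewrite exprMn; lra.
  by have := ler_wpM2l (ltW l_gt0) B_le; rewrite natrM; lra.
Qed.
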